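(* Let $(V,\omega)$ be a real symplectic vector space of dimension $2n$, let $L\in\mathcal{L}(V)$ be a Lagrangian plane and let $0\neq\dot L\in T_L\mathcal{L}(V)$. Then the straight line $\ell(L,\dot L)$ of $\mathbb{P}\Lambda^n(V)$ is contained in $\mathcal{L}(V)$ (identified with its Plücker image) if and only if $\operatorname{rank}(\dot L)=1$.
   Context: $\mathcal{L}(V)$ is the Grassmannian of Lagrangian planes of $(V,\omega)$, i.e. of $n$-dimensional subspaces $L\subset V$ with $\omega|_L=0$; it is a smooth manifold. The Plücker embedding is $\iota:\mathcal{L}(V)\to\mathbb{P}\Lambda^n(V)$, $L=\langle e_1,\dots,e_n\rangle\mapsto[e_1\wedge\cdots\wedge e_n]$, and $\mathcal{L}(V)$ is identified with $\iota(\mathcal{L}(V))$. For $0\neq\dot L\in T_L\mathcal{L}(V)$, $\ell(L,\dot L)$ denotes the projective line of $\mathbb{P}\Lambda^n(V)$ passing through $\iota(L)$ with tangent direction $d\iota(\dot L)$. For $\dot L\in T_L\mathcal{L}(V)$ let $\phi_t$ be any one-parameter subgroup of $Sp(V)$ with $\frac{d}{dt}\big|_{t=0}\phi_t(L)=\dot L$, and define the symmetric bilinear form $g^{\dot L}$ on $L$ by $g^{\dot L}(v,w)=\omega\big(\frac{d}{dt}\big|_{t=0}\phi_t(v),w\big)$; it does not depend on the choice of $\phi_t$. The rank of $\dot L$ is by definition the rank of $g^{\dot L}$. *)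

(* Defs.v *)
From HB Require Import structures.
From mathcomp Require Import all_boot all_order all_algebra all_fingroup.
From mathcomp Require Import all_classical all_reals all_analysis.

Set Implicit Arguments.
Unset Strict Implicit.
Unset Printing Implicit Defensive.

Import Order.TTheory GRing.Theory Num.Theory.
Import numFieldNormedType.Exports.

Local Open Scope classical_set_scope.
Local Open Scope ring_scope.

Definition update (T : Type) (n : nat) (x : 'I_n -> T) (i : 'I_n) (u : T) :
    'I_n -> T :=
  fun j => if j == i then u else x j.

Definition multilinear_map (R : realType) (V U : vectType R) (n : nat)
    (f : ('I_n -> V) -> U) : Prop :=
  forall x i (a : R) u v,
    f (update x i (a *: u + v)) = a *: f (update x i u) + f (update x i v).

Definition alternating_map (R : realType) (V U : vectType R) (n : nat)
    (f : ('I_n -> V) -> U) : Prop :=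
  multilinear_map f /\
  forall x (i j : 'I_n), i != j -> x i = x j -> f x = 0.

(** The [n]-th exterior power of [V], given by its universal property: it is
    determined up to a unique isomorphism compatible with [wedge], and it
    exists by [exterior_power_exists] below. *)
Record exterior_power (R : realType) (V : vectType R) (n : nat) :=
  ExteriorPower {
    ext_space :> vectType R ;
    wedge : ('I_n -> V) -> ext_space ;
    wedge_alternating : alternating_map wedge ;
    wedge_universal : forall (U : vectType R) (f : ('I_n -> V) -> U),
      alternating_map f ->
      exists! g : 'Hom(ext_space, U), forall x, g (wedge x) = f x
  }.

Section Existence.
Variables (R : realType) (V : vectType R) (n : nat).

Let m := \dim {:V}.
Let b (i : 'I_m) : V := (vbasis {:V})`_i.

Lemma update_id (T : Type) (x : 'I_n -> T) i : update x i (x i) = x.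
Proof. by apply/funext => j; rewrite /update; case: eqP => [->|]. Qed.

Lemma multilinear_sum (U : vectType R) (f : ('I_n -> V) -> U) x i
    (I : finType) (c : I -> R) (y : I -> V) :
  multilinear_map f ->
  f (update x i (\sum_j c j *: y j)) = \sum_j c j *: f (update x i (y j)).
Proof.
move=> fM.
have f0 : f (update x i 0) = 0.
  by have := fM x i (-1) 0 0; rewrite scaler0 addr0 scaleN1r addNr.
elim/big_rec2: _ => // j u v _ <-; exact: fM.
Qed.

Lemma multilinear_ext (U : vectType R) (f h : ('I_n -> V) -> U) :
  multilinear_map f -> multilinear_map h ->
  (forall s : {ffun 'I_n -> 'I_m}, f (b \o s) = h (b \o s)) ->
  f =1 h.
Proof.
move=> fM hM fh.
suff H k : (k <= n)%N -> forall x,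
    (forall i : 'I_n, (k <= i)%N -> exists j, x i = b j) -> f x = h x.
  by move=> x; apply: (H n) => // i; rewrite leqNgt ltn_ord.
elim: k => [_ x xb|k IH kn x xb].
  have /choice [s sE] : forall i, exists j, x i = b j by move=> i; exact: xb.
  have -> : x = b \o [ffun i => s i] by apply/funext => i /=; rewrite ffunE.
  exact: fh.
pose i0 := Ordinal kn.
have xE : x i0 = \sum_j coord (vbasis {:V}) j (x i0) *: b j.
  exact: coord_vbasis (memvf _).
rewrite -(update_id x i0) xE !multilinear_sum //; apply: eq_bigr => j _.
congr (_ *: _); apply: IH => [|i ki]; first exact: ltnW.
rewrite /update; case: eqVneq => [_|ni]; first by exists j.
apply: xb; rewrite ltn_neqAle ki andbT.
by apply: contraNneq ni => kE; apply/eqP/val_inj.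
Qed.

Lemma alternating_perm (U : vectType R) (f : ('I_n -> V) -> U)
    (s : 'S_n) x : alternating_map f -> f (x \o s) = (-1) ^+ s *: f x.
Proof.
move=> [fM f0]; have [ts -> _] := prod_tpermP s.
suff T i j (y : 'I_n -> V) : i != j -> f (y \o tperm i j) = - f y.
  elim: ts x => [|[i j] ts IH] x.
    rewrite big_nil odd_perm1 scale1r; congr f.
    by apply/funext => k /=; rewrite perm1.
  rewrite big_cons odd_mul_tperm /=.
  have -> : x \o (tperm i j * \prod_(t <- ts) tperm t.1 t.2)%g
     = (x \o (\prod_(t <- ts) tperm t.1 t.2)%g) \o tperm i j.
    by apply/funext => k /=; rewrite permM.
  case: eqVneq => [->|ij] /=.
    rewrite -IH; congr f; apply/funext => k /=.
    by rewrite tperm1 perm1.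
  by rewrite T // IH signrN scaleNr.
move=> ij.
pose z u v := update (update y i u) j v.
have zM1 u u' v : f (z (u + u') v) = f (z u v) + f (z u' v).
  have zE w : z w v = update (update y j v) i w.
    apply/funext => k; rewrite /z /update.
    by case: (eqVneq k j) => [->|//]; rewrite eq_sym (negbTE ij).
  by rewrite !zE -[u]scale1r fM !scale1r.
have zM2 u v v' : f (z u (v + v')) = f (z u v) + f (z u v').
  by rewrite /z -[v]scale1r fM !scale1r.
have z0 u : f (z u u) = 0.
  by apply: (f0 _ i j ij); rewrite /z /update eqxx (negbTE ij) eqxx.
have := z0 (y i + y j).
rewrite zM1 !zM2 !z0 add0r addr0 => /eqP; rewrite addrC addr_eq0 => /eqP.
have -> : z (y j) (y i) = y \o tperm i j.
  apply/funext => k; rewrite /z /update /=.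
  case: tpermP => [->|->|]; rewrite ?eqxx ?(negbTE ij) //.
  by move=> /eqP/negbTE-> /eqP/negbTE->.
by rewrite /z !update_id => ->.
Qed.

Let T := {ffun {ffun 'I_n -> 'I_m} -> R^o}.

Let minors (x : 'I_n -> V) : T :=
  [ffun s : {ffun 'I_n -> 'I_m} =>
     \det (\matrix_(i, j) coord (vbasis {:V}) (s j) (x i))].

Let S : {vspace T} := <<[seq minors (b \o s) | s : {ffun 'I_n -> 'I_m}]>>%VS.

Let w (x : 'I_n -> V) : subvs_of S := vsproj S (minors x).

Let coordb i j : coord (vbasis {:V}) i (b j) = (i == j)%:R.
Proof.
rewrite /b coord_free 1?eq_sym //; exact: basis_free (vbasisP _).
Qed.

Let minors_alt : alternating_map minors.
Proof.
split=> [x i a u v|x i j ij xij]; apply/ffunP => s; rewrite !ffunE.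
  rewrite (@determinant_multilinear _ _ _
    (\matrix_(k, j) coord (vbasis {:V}) (s j) (update x i u k))
    (\matrix_(k, j) coord (vbasis {:V}) (s j) (update x i v k)) i a 1) ?mul1r //.
  - by apply/rowP => k; rewrite !mxE /update eqxx linearP mul1r.
  - apply/matrixP => k l; rewrite !mxE /update.
    by rewrite eq_sym (negbTE (neq_lift _ _)).
  - apply/matrixP => k l; rewrite !mxE /update.
    by rewrite eq_sym (negbTE (neq_lift _ _)).
by apply: (determinant_alternate ij) => k; rewrite !mxE xij.
Qed.

Let w_alt : alternating_map w.
Proof.
have [M A] := minors_alt; split=> [x i a u v|x i j ij xij].
  by rewrite /w M linearP.
by rewrite /w (A x i j) // linear0.
Qed.

Let w_universal (U : vectType R) (f : ('I_n -> V) -> U) :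
  alternating_map f ->
  exists! g : 'Hom(subvs_of S, U), forall x, g (w x) = f x.
Proof.
move=> fA.
pose G (y : T) : U := (n`!%:R)^-1 *: \sum_s y s *: f (b \o s).
have GL : linear G.
  move=> a u v; rewrite /G [a *: (_^-1 *: _)]scalerA mulrC -scalerA -scalerDr.
  congr (_ *: _); rewrite scaler_sumr -big_split; apply: eq_bigr => s _ /=.
  by rewrite !ffunE scalerDl scalerA.
have Gb (t : {ffun 'I_n -> 'I_m}) : G (minors (b \o t)) = f (b \o t).
  rewrite /G.
  under eq_bigr => s _ do rewrite ffunE scaler_suml.
  rewrite exchange_big /=.
  have E (s : 'S_n) : \sum_(i : {ffun 'I_n -> 'I_m})
     ((-1) ^+ s * \prod_i0 (\matrix_(i1, j)
        coord (vbasis {:V}) (i j) ((b \o t) i1)) i0 (s i0)) *: f (b \o i)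
     = f (b \o t).
    pose t' : {ffun 'I_n -> 'I_m} := [ffun i => t (s^-1%g i)].
    rewrite (bigD1 t') //= [X in _ + X]big1 ?addr0 => [|i it].
      rewrite big1 ?mulr1 => [|i _]; last first.
        by rewrite mxE /= coordb ffunE permK eqxx.
      have -> : b \o t' = (b \o t) \o (s^-1)%g.
        by apply/funext => k /=; rewrite ffunE.
      rewrite (alternating_perm _ _ fA) odd_permV scalerA -signr_addb.
      by rewrite addbb scale1r.
    have [k ki] : exists k, i (s k) != t k.
      apply: contrapT => /forallNP H; move/eqP: it; apply.
      apply/ffunP => k; rewrite ffunE; apply/eqP/negPn/negP => h.
      by apply: (H (s^-1%g k)); rewrite permKV.
    by rewrite (bigD1 k) //= mxE /= coordb (negbTE ki) mul0r mulr0 scale0r.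
  under eq_bigr => s _ do rewrite E.
  by rewrite sumr_const card_Sn -[X in _ *: X]scaler_nat scalerA mulVf ?scale1r //.
have inS (s : {ffun 'I_n -> 'I_m}) : minors (b \o s) \in S.
  by apply: memv_span; apply: map_f; rewrite mem_enum.
pose GT := GRing.isLinear.Build R T U *:%R G GL.
pose Gl : {linear T -> U} := HB.pack G GT.
pose g : 'Hom(subvs_of S, U) := (linfun Gl \o linfun (@vsval _ _ S))%VF.
have gw x : g (w x) = f x.
  apply: (multilinear_ext (f := fun x => g (w x)) (h := f)) => [y i a u v||s].
  - by rewrite w_alt.1 linearP.
  - exact: fA.1.
  by rewrite /g comp_lfunE !lfunE /= /w vsprojK.
exists g; split=> // g' g'w; apply/lfunP => z.
have zS : vsval z \in S by exact: subvsP.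
pose sS := [seq minors (b \o s) | s : {ffun 'I_n -> 'I_m}].
have := zS; rewrite -[S]/(<<in_tuple sS>>%VS) => /coord_span zE.
have -> : z = \sum_i coord (in_tuple sS) i (vsval z) *: vsproj S sS`_i.
  rewrite -[LHS]vsvalK zE linear_sum; apply: eq_bigr => i _.
  by rewrite linearZ -zE.
rewrite !linear_sum; apply: eq_bigr => i _; rewrite !linearZ; congr (_ *: _).
have : sS`_i \in sS by exact: mem_nth.
by move=> /mapP [s _ ->]; exact: etrans (gw (b \o s)) (esym (g'w (b \o s))).
Qed.

Theorem exterior_power_exists : exists E : exterior_power V n, True.
Proof. by exists (ExteriorPower w_alt w_universal). Qed.

End Existence.

(** A [vectType] carries no topology; differentiating coordinates gives the
    usual notion, independently of the basis. *)

Definition vderivable (R : realType) (W : vectType R) (c : R -> W) (t : R) :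
    Prop :=
  forall i, derivable (fun s => coord (vbasis {:W}) i (c s) : R^o) t 1.

Definition vderive (R : realType) (W : vectType R) (c : R -> W) (t : R) : W :=
  \sum_i derive1 (fun s => coord (vbasis {:W}) i (c s) : R^o) t
            *: (vbasis {:W})`_i.

Definition lagrangian (R : realType) (V : vectType R) (n : nat)
    (omega : {skew_symmetric V}) : set {vspace V} :=
  [set L | \dim L = n /\ {in L &, forall u v, omega u v = 0}].

(** [e] is, near time 0, a basis of the moving [k]-dimensional subspace [c],
    differentiable at time 0. In the manifold structure of the Grassmannian, a
    curve is differentiable at time 0 iff it has such a frame. *)
Definition moving_frame (R : realType) (V : vectType R) (k : nat)
    (c : R -> {vspace V}) (e : R -> 'I_k -> V) : Prop :=
  (\forall t \near (0 : R), basis_of (c t) [seq e t i | i : 'I_k]) /\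
  forall i, vderivable (e ^~ i) 0.

Definition lagrangian_curve (R : realType) (V : vectType R) (n : nat)
    (omega : {skew_symmetric V}) (L : {vspace V}) (c : R -> {vspace V}) :
    Prop :=
  [/\ c 0 = L, forall t, lagrangian n omega (c t)
    & exists e : R -> 'I_n -> V, moving_frame c e].

(** The velocity of a curve through [L] is the element of [Hom(L, V / L)]
    sending [e 0 i] to the class of the derivative of [e ^~ i] at 0, for any
    moving frame [e] of the curve. *)
Definition same_velocity (R : realType) (V : vectType R) (n : nat)
    (c1 c2 : R -> {vspace V}) : Prop :=
  exists e1 e2 : R -> 'I_n -> V,
    [/\ moving_frame c1 e1, moving_frame c2 e2, e1 0 = e2 0
      & forall i, vderive (e1 ^~ i) 0 - vderive (e2 ^~ i) 0 \in c1 0].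

(** Tangent vectors are equivalence classes of curves. *)
Definition velocity (R : realType) (V : vectType R) (n : nat)
    (omega : {skew_symmetric V}) (L : {vspace V}) (c : R -> {vspace V}) :
    set (R -> {vspace V}) :=
  [set c' | lagrangian_curve n omega L c' /\ same_velocity n c c'].

Definition tangent_space (R : realType) (V : vectType R) (n : nat)
    (omega : {skew_symmetric V}) (L : {vspace V}) :
    set (set (R -> {vspace V})) :=
  [set velocity n omega L c | c in lagrangian_curve n omega L].

Definition tangent_zero (R : realType) (V : vectType R) (n : nat)
    (omega : {skew_symmetric V}) (L : {vspace V}) : set (R -> {vspace V}) :=
  velocity n omega L (fun=> L).

(** Points of the projective space of [E] are the subspaces of [E] of
    dimension 1. *)

Definition pluecker (R : realType) (V : vectType R) (n : nat)
    (E : exterior_power V n) (L : {vspace V}) : {vspace E} :=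
  <[wedge E (fun i : 'I_n => (vbasis L)`_i)]>%VS.

(** The line through the image [<[w 0]>] of [L] with direction the velocity of
    the image [<[w t]>] of a curve in the class [Ldot], as a set of points.
    The plane spanned by [w 0] and the derivative of [w] at 0 depends neither
    on the curve nor on its homogeneous lift [w]. *)
Definition tangent_line (R : realType) (V : vectType R) (n : nat)
    (E : exterior_power V n) (Ldot : set (R -> {vspace V})) :
    set {vspace E} :=
  [set p : {vspace E} | \dim p = 1%N /\
    exists (c : R -> {vspace V}) (w : R -> E),
      [/\ Ldot c,
          \forall t \near (0 : R), pluecker E (c t) = <[w t]>%VS,
          vderivable w 0
        & (p <= <[w 0%R]> + <[vderive w 0%R]>)%VS]].

Arguments tangent_line {R V n} E Ldot.

Definition one_parameter_subgroup (R : realType) (V : vectType R)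
    (omega : {skew_symmetric V}) (phi : R -> 'End(V)) : Prop :=
  [/\ phi 0 = \1%VF,
      forall s t, phi (s + t) = (phi s \o phi t)%VF,
      forall t u v, omega (phi t u) (phi t v) = omega u v
    & forall t v, vderivable (fun s => phi s v) t].

(** A one-parameter subgroup of the symplectic group with
    [d/dt phi_t(L) = Ldot] at [t = 0]; one exists for every tangent vector. *)
Definition generator (R : realType) (V : vectType R)
    (omega : {skew_symmetric V}) (L : {vspace V})
    (Ldot : set (R -> {vspace V})) : R -> 'End(V) :=
  xget (fun=> \1%VF)
    [set phi : R -> 'End(V) | one_parameter_subgroup omega phi /\
       Ldot (fun t => (phi t @: L)%VS)].

Definition tangent_form (R : realType) (V : vectType R)
    (omega : {skew_symmetric V}) (L : {vspace V})
    (Ldot : set (R -> {vspace V})) (v w : V) : R :=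
  omega (vderive (fun t => generator omega L Ldot t v) 0) w.

Definition form_rank (R : realType) (V : vectType R) (L : {vspace V})
    (g : V -> V -> R) : nat :=
  \rank (\matrix_(i < \dim L, j < \dim L) g (vbasis L)`_i (vbasis L)`_j).

Definition tangent_rank (R : realType) (V : vectType R)
    (omega : {skew_symmetric V}) (L : {vspace V})
    (Ldot : set (R -> {vspace V})) : nat :=
  form_rank L (tangent_form omega L Ldot).

(* Main.v *)
From HB Require Import structures.
Require Import Defs.
From mathcomp Require Import all_boot all_order all_algebra all_fingroup.
From mathcomp Require Import all_classical all_reals all_analysis.
From mathcomp Require Import zify.

Set Implicit Arguments.
Unset Strict Implicit.
Unset Printing Implicit Defensive.

Import Order.TTheory GRing.Theory Num.Theory.
Import numFieldNormedType.Exports.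

Local Open Scope classical_set_scope.
Local Open Scope ring_scope.

(** Fix a basis [b] of [L]. A Lagrangian curve through [L] has a moving frame
    [e] with [e 0 = b], and its velocity is recorded by the matrix
    [G i j = omega (e_i') (b j)]. Differentiating the identity
    [omega (e1 t i) (e2 t j) = 0] for two frames of one curve
    ([frame_pairing]) shows at once that [G] is symmetric and that it does not
    depend on the frame. Since a Lagrangian plane is its own orthogonal, two
    curves have the same velocity iff they have the same matrix: tangent
    vectors correspond to symmetric matrices ([tangent_space_form]), and the
    zero vector to the zero matrix. Conversely every symmetric [G] is the matrix
    of the curve [(1 + t A) L], where [A] sends [b i] to the sum of the
    [G i j *: f j], the [f j] spanning a Lagrangian complement dual to [b], and
    vanishes on this complement. As [A] squares to 0, [1 + t A] is a
    one-parameter group of symplectic maps ([shear_group]), so the rank of the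
    tangent vector is the rank of [G] ([tangent_rank_form]).

    By the product rule for multilinear maps, the projective line joins the
    points [W] and [W'], where [W] is the wedge of the [b i] and [W'] is the
    sum over [i] of the wedges in which [b i] is replaced by [e_i']
    ([tangent_plane]).

    If [G] has rank 1, a change of basis leaves a single nonzero entry, on the
    diagonal at [k]. Then [e_i'] lies in [L] for [i != k], so the line consists
    of the wedges in which [b k] is replaced by some combination of [b k] and
    [e_k']; each of these families spans a Lagrangian plane
    ([rank1_line_lagrangian]).

    Conversely, the single point [W + W'] already forces rank 1. If it is a
    wedge of vectors [x i] with coordinates [(P | Q)] in the basis [(b, f)],
    the functionals [x |-> det (P + Q K)] give
    [l * det (P + Q K) = 1 + tr (G K)] for some scalar [l] and all matrices
    [K]: [W + W'] has no component of order 2 or more in the [f j]. So [Q]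
    equals [P G], and [det (1 + G K) = 1 + tr (G K)] for all [K]. This forces
    the rank [r] of [G] to be at most 1, since for a [K] that makes [G K] a
    projection of rank [r] it reads [2 ^ r = 1 + r]
    ([rank1_of_graph_minors]). *)

(** * Families of vectors *)

Section Families.
Variables (R : realType) (V : vectType R) (n : nat).
Implicit Types (b x : 'I_n -> V).

Let enumE b : [seq b i | i : 'I_n] = [tuple b i | i < n].
Proof. by []. Qed.

Lemma span_familyP b v :
  reflect (exists a : 'I_n -> R, v = \sum_i a i *: b i)
          (v \in <<[seq b i | i : 'I_n]>>%VS).
Proof.
apply: (iffP idP) => [|[a ->]].
  rewrite enumE => /coord_span ->.
  exists (fun i => coord [tuple b i | i < n] i v); apply: eq_bigr => i _.
  by rewrite -tnth_nth tnth_mktuple.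
apply: memv_suml => i _; apply: memvZ; apply: memv_span.
by apply: map_f; rewrite mem_enum.
Qed.

Lemma free_familyP b :
  reflect (forall a : 'I_n -> R, \sum_i a i *: b i = 0 -> forall i, a i = 0)
          (free [seq b i | i : 'I_n]).
Proof.
rewrite enumE; apply: (iffP (@freeP _ _ _ [tuple b i | i < n])) =>
  H a a0; apply: H; rewrite -[RHS]a0;
  by apply: eq_bigr => i _; rewrite -tnth_nth tnth_mktuple.
Qed.

Lemma mem_span_family b i : b i \in <<[seq b i | i : 'I_n]>>%VS.
Proof. by apply: memv_span; apply: map_f; rewrite mem_enum. Qed.

Lemma size_family b : size [seq b i | i : 'I_n] = n.
Proof. by rewrite size_image card_ord. Qed.

Lemma basis_family_mem U b i : basis_of U [seq b i | i : 'I_n] -> b i \in U.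
Proof. by move=> /span_basis <-; exact: mem_span_family. Qed.

(** The dual family is defined on the whole of [V], whereas [b] is a basis of a
    subspace only: this is what lets a Lagrangian basis be paired with vectors
    of [V] by nondegeneracy. *)
Lemma basis_family_coord b :
  free [seq b i | i : 'I_n] ->
  exists xi : 'I_n -> {linear V -> R^o}, forall i j, xi i (b j) = (i == j)%:R.
Proof.
rewrite enumE => bf; exists (coord [tuple b i | i < n]) => i j.
have := @coord_free _ _ _ [tuple b i | i < n] j i bf.
by rewrite -tnth_nth tnth_mktuple eq_sym.
Qed.

Definition mxcomb (B : 'M[R]_n) b : 'I_n -> V := fun i => \sum_j B i j *: b j.

Lemma basis_comb U B b : B \in unitmx ->
  basis_of U [seq b i | i : 'I_n] -> basis_of U [seq mxcomb B b i | i : 'I_n].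
Proof.
move=> Bu bU; have bf := basis_free bU.
have cU i : mxcomb B b i \in U.
  by apply: memv_suml => j _; apply/memvZ/basis_family_mem.
rewrite basisEfree size_family; apply/and3P; split.
- apply/free_familyP => a; rewrite /mxcomb.
  under eq_bigr => i _ do rewrite scaler_sumr.
  rewrite exchange_big /=.
  under eq_bigr => j _ do
    (under eq_bigr => i _ do rewrite scalerA; rewrite -scaler_suml).
  move/free_familyP: bf => /[apply] aB i.
  have a0 : (\row_i a i) *m B = 0.
    apply/rowP => j; rewrite !mxE -[RHS](aB j).
    by apply: eq_bigr => k _; rewrite mxE.
  have := mulmxK Bu (\row_i a i); rewrite a0 mul0mx => /rowP /(_ i).
  by rewrite !mxE => <-.
- by apply/span_subvP => _ /mapP[i _ ->].
- have /eqnP : free [seq b i | i : 'I_n] by [].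
  by rewrite size_family (span_basis bU) => ->.
Qed.

Lemma basis_change U b b' :
  basis_of U [seq b i | i : 'I_n] -> basis_of U [seq b' i | i : 'I_n] ->
  exists2 B : 'M[R]_n, B \in unitmx & b' = mxcomb B b.
Proof.
move=> bU b'U.
have /choice [B BE] : forall i, exists a : 'I_n -> R, b' i = \sum_j a j *: b j.
  by move=> i; apply/span_familyP; rewrite (span_basis bU) basis_family_mem.
have b'E : b' = mxcomb (\matrix_(i, j) B i j) b.
  apply/funext => i; rewrite BE.
  by apply: eq_bigr => j _; rewrite mxE.
exists (\matrix_(i, j) B i j) => //.
rewrite -row_free_unit; apply: inj_row_free => v vB.
have /free_familyP b'f := basis_free b'U.
apply/rowP => i; rewrite mxE; apply: (b'f (v 0)).
rewrite b'E /mxcomb; under eq_bigr => k _ do rewrite scaler_sumr.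
rewrite exchange_big big1 //= => j _.
under eq_bigr => k _ do rewrite scalerA.
rewrite -scaler_suml; move/rowP: vB => /(_ j).
by rewrite !mxE => ->; rewrite scale0r.
Qed.

End Families.

Lemma basis_vbasis (R : realType) (V : vectType R) n (U : {vspace V}) :
  \dim U = n -> basis_of U [seq (vbasis U)`_i | i : 'I_n].
Proof.
move=> <-; have -> : [seq (vbasis U)`_i | i : 'I_(\dim U)] = vbasis U.
  rewrite -[RHS]/(tval (vbasis U)) [vbasis U in RHS]tuple_map_ord /=.
  by apply: eq_map => i; rewrite -tnth_nth.
exact: vbasisP.
Qed.

Lemma dim1_line (R : realType) (V : vectType R) (U : {vspace V}) :
  \dim U = 1%N -> exists2 v, v != 0 & U = <[v]>%VS.
Proof.
move=> dU; have v0 : vpick U != 0 by rewrite vpick0 -dimv_eq0 dU.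
exists (vpick U) => //; apply/esym/eqP.
by rewrite eqEdim -memvE memv_pick dim_vline v0 dU.
Qed.

(** * Alternating maps *)

Section Alternating.
Variables (R : realType) (V U : vectType R) (n : nat).
Variable f : ('I_n -> V) -> U.

Lemma update_self (x : 'I_n -> V) i u : update x i u i = u.
Proof. by rewrite /update eqxx. Qed.

Lemma update_neq (x : 'I_n -> V) i j u : j != i -> update x i u j = x j.
Proof. by rewrite /update => /negbTE ->. Qed.

Lemma update_comm (x : 'I_n -> V) i j u v : i != j ->
  update (update x i u) j v = update (update x j v) i u.
Proof.
move=> ij; apply/funext => k; rewrite /update.
by case: (eqVneq k j) => // ->; rewrite eq_sym (negbTE ij).
Qed.

Lemma multilinear0 x i : multilinear_map f -> f (update x i 0) = 0.
Proof.
by move=> fM; have := fM x i (-1) 0 0; rewrite scaler0 addr0 scaleN1r addNr.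
Qed.

Hypothesis fA : alternating_map f.

Lemma alternating_update x i j : i != j -> f (update x i (x j)) = 0.
Proof.
move=> ij; apply: (fA.2 _ i j ij).
by rewrite update_self update_neq // eq_sym.
Qed.

(** The arguments are replaced one after the other by members of [b]; once all
    of them are, either two coincide or [x] is a permutation of [b]. *)
Lemma alternating_span (b x : 'I_n -> V) :
  (forall i, x i \in <<[seq b i | i : 'I_n]>>%VS) -> f x \in <[f b]>%VS.
Proof.
suff H k : (k <= n)%N -> forall x,
    (forall i, x i \in <<[seq b i | i : 'I_n]>>%VS) ->
    (forall i : 'I_n, (k <= i)%N -> exists j, x i = b j) -> f x \in <[f b]>%VS.
  by move=> xb; apply: (H n) => // i; rewrite leqNgt ltn_ord.
elim: k => [_ {}x _ xb|k IH kn {}x xs xb].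
  have /choice [s sE] : forall i, exists j, x i = b j by move=> i; exact: xb.
  have xE : x = b \o s by apply/funext.
  have [/injectiveP si|/injectivePn [i [j ij sij]]] := boolP (injectiveb s).
    have -> : x = b \o perm si.
      by rewrite xE; apply/funext => i /=; rewrite permE.
    by rewrite (alternating_perm _ _ fA) memvZ ?memv_line.
  by rewrite (fA.2 _ i j ij) ?mem0v // !sE sij.
pose i0 := Ordinal kn.
have /span_familyP [a aE] := xs i0.
rewrite -(update_id x i0) aE (multilinear_sum _ _ _ _ fA.1).
apply: memv_suml => j _; apply: memvZ; apply: IH => [|i|i ki].
- exact: ltnW.
- by rewrite /update; case: eqP => // _; exact: mem_span_family.
rewrite /update; case: eqVneq => [_|ni]; first by exists j.
apply: xb; rewrite ltn_neqAle ki andbT.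
by apply: contraNneq ni => kE; apply/eqP/val_inj.
Qed.

Lemma alternating_free x : f x != 0 -> free [seq x i | i : 'I_n].
Proof.
move=> fx0; apply/free_familyP => a a0 k; apply: contraNeq fx0 => ak.
have xk : x k = \sum_j (if j == k then 0 else - (a k)^-1 * a j) *: x j.
  rewrite (bigD1 k) //= eqxx scale0r add0r.
  under eq_bigr => j jk do rewrite (negbTE jk) -scalerA.
  rewrite -scaler_sumr; move: a0; rewrite (bigD1 k) //= addrC => /eqP.
  rewrite addr_eq0 => /eqP ->.
  by rewrite scalerN scaleNr opprK scalerA mulVf ?scale1r.
rewrite -(update_id x k) xk (multilinear_sum _ _ _ _ fA.1) big1 // => j _.
case: eqVneq => [_|jk]; first by rewrite scale0r.
by rewrite alternating_update ?scaler0 // eq_sym.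
Qed.

Lemma alternating_basis W (b x : 'I_n -> V) :
  basis_of W [seq b i | i : 'I_n] -> basis_of W [seq x i | i : 'I_n] ->
  <[f x]>%VS = <[f b]>%VS.
Proof.
move=> bW xW.
have inS (y z : 'I_n -> V) : basis_of W [seq y i | i : 'I_n] ->
  basis_of W [seq z i | i : 'I_n] -> f y \in <[f z]>%VS.
  move=> yW zW; apply: alternating_span => i.
  by rewrite (span_basis zW); exact: basis_family_mem.
by apply/eqP; rewrite eqEsubv -!memvE !inS.
Qed.

End Alternating.

(** * Differentiation in coordinates *)

Section Velocity.
Variables (R : realType).
Implicit Types (V W : vectType R) (t : R).

(** [vderivable] and [vderive] together, in the style of [is_derive], so that
    the derivative is computed along with the proof that it exists. *)
Definition is_vderive V (c : R -> V) t (d : V) : Prop :=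
  forall i, is_derive t (1 : R) (fun s => coord (vbasis {:V}) i (c s) : R^o)
    (coord (vbasis {:V}) i d).

Lemma vbasis_coordE V (v : V) :
  v = \sum_i coord (vbasis {:V}) i v *: (vbasis {:V})`_i.
Proof. exact: coord_vbasis (memvf v). Qed.

Lemma vderivable_is_vderive V (c : R -> V) t :
  vderivable c t -> is_vderive c t (vderive c t).
Proof.
move=> cd i; apply: DeriveDef; first exact: cd.
rewrite /vderive coord_sum_free ?derive1E //.
exact: basis_free (vbasisP _).
Qed.

Lemma is_vderive_vderive V (c : R -> V) t d :
  is_vderive c t d -> vderivable c t /\ vderive c t = d.
Proof.
move=> cd; split=> [i|]; first by case: (cd i).
rewrite /vderive [RHS]vbasis_coordE; apply: eq_bigr => i _.
by rewrite derive1E; case: (cd i) => _ ->.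
Qed.

Lemma is_vderive_unique V (c : R -> V) t d d' :
  is_vderive c t d -> is_vderive c t d' -> d = d'.
Proof. by move=> /is_vderive_vderive [_ <-] /is_vderive_vderive [_ <-]. Qed.

Lemma near_is_vderive V (c c' : R -> V) t d :
  (\forall s \near t, c s = c' s) -> is_vderive c t d -> is_vderive c' t d.
Proof.
move=> cc' cd i; apply: near_eq_is_derive (cd i).
by apply: filterS cc' => s ->.
Qed.

Lemma is_vderive_cst V (v : V) t : is_vderive (fun=> v) t 0.
Proof. by move=> i; rewrite linear0; exact: is_derive_cst. Qed.

Lemma is_derive_sumr (I : finType) (h : I -> R -> R) t (dh : I -> R) :
  (forall i, is_derive t (1 : R) (h i : R -> R^o) (dh i)) ->
  is_derive t (1 : R) ((fun s => \sum_i h i s) : R -> R^o) (\sum_i dh i).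
Proof.
move=> hd.
have -> : (fun s => \sum_i h i s) = \sum_i h i.
  by apply/funext => s; rewrite fct_sumE.
by elim/big_ind2 : _ => // [|] *; [exact: is_derive_cst|exact: is_deriveD].
Qed.

Lemma is_derive_mulr (f g : R -> R) t (df dg : R) :
  is_derive t (1 : R) (f : R -> R^o) df ->
  is_derive t (1 : R) (g : R -> R^o) dg ->
  is_derive t (1 : R) ((fun s => f s * g s) : R -> R^o) (df * g t + f t * dg).
Proof.
move=> fd gd; have := is_deriveM fd gd; rewrite /GRing.scale /= => h.
by apply: is_derive_eq h _; rewrite addrC [g t * _]mulrC.
Qed.

Lemma is_vderive_scalar V (phi : {linear V -> R^o}) (c : R -> V) t d :
  is_vderive c t d ->
  is_derive t (1 : R) ((fun s => phi (c s)) : R -> R^o) (phi d).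
Proof.
move=> cd; rewrite [d]vbasis_coordE linear_sum.
have -> : (fun s => phi (c s)) = (fun s => \sum_i
   coord (vbasis {:V}) i (c s) * phi (vbasis {:V})`_i).
  apply/funext => s; rewrite {1}[c s]vbasis_coordE linear_sum.
  by apply: eq_bigr => i _; rewrite linearZ.
apply: is_derive_sumr => i; rewrite linearZ /=.
apply: is_derive_eq.
  exact: (is_derive_mulr (cd i) (is_derive_cst _ _ _)).
by rewrite mulr0 addr0.
Qed.

Lemma is_vderive_linear V W (phi : {linear V -> W}) (c : R -> V) t d :
  is_vderive c t d -> is_vderive (fun s => phi (c s)) t (phi d).
Proof.
move=> cd i.
exact: (is_vderive_scalar (coord (vbasis {:W}) i \o phi) cd).
Qed.

Lemma is_vderiveZ V (a : R -> R) (c : R -> V) t a' d :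
  is_derive t (1 : R) (a : R -> R^o) a' -> is_vderive c t d ->
  is_vderive (fun s => a s *: c s) t (a' *: c t + a t *: d).
Proof.
move=> ad cd i; rewrite linearD !linearZ /=.
have -> : (fun s => coord (vbasis {:V}) i (a s *: c s)) =
  (fun s => a s * coord (vbasis {:V}) i (c s)).
  by apply/funext => s; rewrite linearZ.
exact: is_derive_mulr.
Qed.

Lemma is_vderiveD V (c c' : R -> V) t d d' :
  is_vderive c t d -> is_vderive c' t d' ->
  is_vderive (fun s => c s + c' s) t (d + d').
Proof.
move=> cd c'd i; rewrite linearD.
have -> : (fun s => coord (vbasis {:V}) i (c s + c' s)) =
  (fun s => coord (vbasis {:V}) i (c s)) +
  (fun s => coord (vbasis {:V}) i (c' s)).
  by apply/funext => s; rewrite linearD.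
exact: is_deriveD (cd i) (c'd i).
Qed.

Lemma is_vderive_sum V (I : finType) (c : I -> R -> V) t (d : I -> V) :
  (forall j, is_vderive (c j) t (d j)) ->
  is_vderive (fun s => \sum_j c j s) t (\sum_j d j).
Proof.
move=> cd i; rewrite linear_sum.
have -> : (fun s => coord (vbasis {:V}) i (\sum_j c j s)) =
  (fun s => \sum_j coord (vbasis {:V}) i (c j s)).
  by apply/funext => s; rewrite linear_sum.
by apply: is_derive_sumr => j; exact: cd.
Qed.

Lemma is_vderive_comb V n (B : 'M[R]_n) (e : R -> 'I_n -> V) t d :
  (forall i, is_vderive (e ^~ i) t (d i)) ->
  forall i, is_vderive (fun s => mxcomb B (e s) i) t (mxcomb B d i).
Proof.
move=> ed i; apply: is_vderive_sum => j.
exact: (is_vderive_linear (GRing.scale (B i j)) (ed j)).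
Qed.

Lemma is_vderive_affine V (u v : V) t : is_vderive (fun s => u + s *: v) t v.
Proof.
have sv : is_vderive (fun s => s *: v) t (1 *: v + t *: 0).
  exact: is_vderiveZ (is_derive_id _ _) (is_vderive_cst v t).
have := is_vderiveD (is_vderive_cst u t) sv.
by rewrite scale1r scaler0 addr0 add0r.
Qed.

(** Expanding one argument at a time in a basis of [V] reduces this to the
    product rule for scalars: the induction is on the number of arguments that
    are allowed to vary. *)
Lemma is_vderive_multilinear V W n (f : ('I_n -> V) -> W)
    (e : R -> 'I_n -> V) t (d : 'I_n -> V) :
  multilinear_map f -> (forall i, is_vderive (e ^~ i) t (d i)) ->
  is_vderive (fun s => f (e s)) t (\sum_i f (update (e t) i (d i))).
Proof.
move=> fM.
suff H k : (k <= n)%N -> forall e d,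
    (forall i, is_vderive (e ^~ i) t (d i)) ->
    (forall i : 'I_n, (k <= i)%N -> (forall s, e s i = e t i) /\ d i = 0) ->
    is_vderive (fun s => f (e s)) t (\sum_i f (update (e t) i (d i))).
  by move=> ed; apply: (H n) => // i; rewrite leqNgt ltn_ord.
elim: k => [_ {}e {}d _ ec|k IH kn {}e {}d ed ec].
  have -> : (fun s => f (e s)) = fun=> f (e t).
    by apply/funext => s; congr f; apply/funext => i; case: (ec i).
  rewrite big1 => [|i _]; first exact: is_vderive_cst.
  by have [_ ->] := ec i isT; exact: multilinear0.
pose i0 := Ordinal kn; pose vb := vbasis {:V}.
have -> : (fun s => f (e s)) =
    (fun s => \sum_j coord vb j (e s i0) *: f (update (e s) i0 vb`_j)).
  apply/funext => s; rewrite -(multilinear_sum _ _ _ _ fM) -vbasis_coordE.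
  by rewrite update_id.
(* The derivative of the map with argument [i0] frozen at the [j]-th basis
   vector; its [i0]-th term vanishes. *)
pose D j := \sum_i f (update (update (e t) i0 vb`_j) i (update d i0 0 i)).
have DE : \sum_i f (update (e t) i (d i)) =
  \sum_j (coord vb j (d i0) *: f (update (e t) i0 vb`_j) +
          coord vb j (e t i0) *: D j).
  rewrite big_split /= -(multilinear_sum _ _ _ _ fM) -vbasis_coordE.
  rewrite (bigD1 i0) //=; congr (_ + _).
  under [RHS]eq_bigr => j _ do rewrite /D scaler_sumr.
  rewrite exchange_big /= [RHS](bigD1 i0) //= [X in _ = X + _]big1 ?add0r.
    apply: eq_bigr => i ii0.
    rewrite -[e t in LHS](update_id _ i0) update_comm 1?eq_sym //.
    rewrite [in LHS](vbasis_coordE (e t i0)) (multilinear_sum _ _ _ _ fM).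
    apply: eq_bigr => j _; rewrite update_comm 1?eq_sym //.
    by rewrite [update d _ _ _]update_neq.
  by move=> j _; rewrite update_self multilinear0 ?scaler0.
rewrite DE; apply: is_vderive_sum => j.
apply: is_vderiveZ; first exact: ed.
apply: (IH (ltnW kn) (fun s => update (e s) i0 vb`_j) (update d i0 0)) => i.
  rewrite /update; case: eqP => _; last exact: ed.
  exact: is_vderive_cst.
move=> ki; rewrite /update; case: eqVneq => // ni.
apply: ec; rewrite ltn_neqAle ki andbT.
by apply: contraNneq ni => kE; apply/eqP/val_inj.
Qed.

End Velocity.

(** * Lagrangian planes *)

Section Symplectic.
Variables (R : realType) (V : vectType R) (omega : {skew_symmetric V}).

Lemma skewC u v : omega u v = - omega v u.
Proof. by rewrite hermC /= expr1 mulN1r. Qed.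

Lemma skew_sumr (I : finType) u (a : I -> R) (v : I -> V) :
  omega u (\sum_i a i *: v i) = \sum_i a i * omega u (v i).
Proof. by rewrite linear_sum; apply: eq_bigr => i _; rewrite linearZ. Qed.

Lemma skew_suml (I : finType) v (a : I -> R) (u : I -> V) :
  omega (\sum_i a i *: u i) v = \sum_i a i * omega (u i) v.
Proof.
rewrite skewC skew_sumr -sumrN; apply: eq_bigr => i _.
by rewrite [omega (u i) v]skewC mulrN.
Qed.

Lemma skewDl u u' v : omega (u + u') v = omega u v + omega u' v.
Proof. by rewrite skewC linearD opprD -!(skewC _ v). Qed.

Lemma skewZl a u v : omega (a *: u) v = a * omega u v.
Proof. by rewrite skewC linearZ /= -mulrN -skewC. Qed.

Lemma skew_self u : omega u u = 0.
Proof.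
have /eqP := skewC u u; rewrite -addr_eq0 -mulr2n mulrn_eq0 /=.
by move=> /eqP.
Qed.

Lemma linear_lfun (h : V -> V) : linear h ->
  exists T : 'End(V), forall v, T v = h v.
Proof.
move=> hL; pose hT := GRing.isLinear.Build R V V *:%R h hL.
pose hl : {linear V -> V} := HB.pack h hT.
by exists (linfun hl) => v; rewrite lfunE.
Qed.

Lemma skew_tensor_lfun (I : finType) (a : I -> I -> R) (u v : I -> V) :
  exists A : 'End(V),
    forall w, A w = \sum_i (\sum_j a i j * omega (u j) w) *: v i.
Proof.
apply: linear_lfun => c w w'; rewrite scaler_sumr -big_split /=.
apply: eq_bigr => i _; rewrite scalerA -scalerDl; congr (_ *: _).
rewrite mulr_sumr -big_split /=; apply: eq_bigr => j _.
by rewrite linearD linearZ /= mulrDr mulrCA.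
Qed.

Hypothesis omega_nd : nondegenerate omega.

Lemma nondegenerate0 u : (forall v, omega u v = 0) -> u = 0.
Proof.
move=> u0; apply/eqP; rewrite -memv0 -(eqP omega_nd).
by apply/mem_orthovP => v _; exact: u0.
Qed.

(** The Gram matrix of a basis is invertible. *)
Lemma nondegenerate_representable (xi : {linear V -> R^o}) :
  exists f, forall v, omega f v = xi v.
Proof.
pose b := vbasis {:V}; pose m := \dim {:V}.
pose M := \matrix_(i < m, j < m) omega b`_i b`_j.
have Mu : M \in unitmx.
  rewrite -row_free_unit; apply: inj_row_free => v vM.
  have : \sum_i v 0 i *: b`_i = 0.
    apply: nondegenerate0 => w; rewrite (vbasis_coordE w) skew_sumr big1 //.
    move=> j _; rewrite skew_suml; move/rowP: vM => /(_ j); rewrite !mxE => vM.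
    under eq_bigr => i _ do [have -> : omega b`_i b`_j = M i j by rewrite mxE].
    by rewrite vM mulr0.
  move: (basis_free (vbasisP {:V})) => /freeP /[apply] v0.
  by apply/rowP => i; rewrite v0 mxE.
pose x := (\row_j xi b`_j) *m invmx M.
exists (\sum_i x 0 i *: b`_i) => v.
rewrite (vbasis_coordE v) skew_sumr linear_sum; apply: eq_bigr => j _.
rewrite linearZ skew_suml.
have -> : xi b`_j = (x *m M) 0 j by rewrite mulmxKV // mxE.
rewrite [(x *m M) 0 j]mxE; congr (_ * _); apply: eq_bigr => i _.
by rewrite [M i j]mxE.
Qed.

(** The family [f] spans a Lagrangian complement of [L]. Nondegeneracy yields
    vectors [g i] dual to [b] but not orthogonal to one another; adding to
    [g i] an element of [L] keeps the duality, and half of the pairings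
    [omega (g i) (g k)] is what is needed since it enters twice, once for each
    of the two arguments. *)
Lemma lagrangian_dual n L (b : 'I_n -> V) :
  lagrangian n omega L -> basis_of L [seq b i | i : 'I_n] ->
  exists f : 'I_n -> V, (forall i j, omega (f i) (b j) = (i == j)%:R) /\
    (forall i j, omega (f i) (f j) = 0).
Proof.
move=> [_ Lo] bL; have bb i j : omega (b i) (b j) = 0.
  by apply: Lo; exact: basis_family_mem.
have [xi xiE] := basis_family_coord (basis_free bL).
have /choice [g gE] : forall i, exists f, forall v, omega f v = xi i v.
  by move=> i; exact: nondegenerate_representable.
exists (fun i => g i + \sum_k (omega (g i) (g k) / 2) *: b k).
have gb i j : omega (g i) (b j) = (i == j)%:R by rewrite gE.
have bs i (c : 'I_n -> R) : omega (\sum_k c k *: b k) (b i) = 0.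
  by rewrite skew_suml big1 // => k _; rewrite bb mulr0.
have gs i (c : 'I_n -> R) : omega (g i) (\sum_k c k *: b k) = c i.
  rewrite skew_sumr (bigD1 i) //= gb eqxx mulr1 big1 ?addr0 // => k ki.
  by rewrite gb eq_sym (negbTE ki) mulr0.
split=> i j; first by rewrite skewDl bs addr0.
rewrite skewDl !linearD /= gs [omega (\sum_k _) (g j)]skewC gs skew_sumr.
rewrite [X in _ + (_ + X)]big1 => [|k _]; last by rewrite bs mulr0.
by rewrite [omega (g j) _]skewC mulNr addr0 -addrA -opprD -splitr subrr.
Qed.

(** A Lagrangian plane is its own orthogonal, by counting dimensions: [L] is
    contained both in the kernel and in the image of the endomorphism
    [w |-> \sum_i omega (b i) w *: b i], whose kernel is the orthogonal
    of [L]. *)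
Lemma lagrangian_maximal n L v : \dim {:V} = (2 * n)%N ->
  lagrangian n omega L -> {in L, forall u, omega v u = 0} -> v \in L.
Proof.
move=> dV LL vL; have [dL Lo] := LL; subst n.
pose b (i : 'I_(\dim L)) := (vbasis L)`_i.
have bL : basis_of L [seq b i | i : 'I_(\dim L)] := basis_vbasis erefl.
have [f [fb _]] := lagrangian_dual LL bL.
have [T TE] := skew_tensor_lfun (fun i j => (i == j)%:R) b b.
have Tb w : T w = \sum_i omega (b i) w *: b i.
  rewrite TE; apply: eq_bigr => i _; congr (_ *: _).
  rewrite (bigD1 i) //= eqxx mul1r big1 ?addr0 // => j ji.
  by rewrite eq_sym (negbTE ji) mul0r.
have Lker : (L <= lker T)%VS.
  apply/subvP => u uL; rewrite memv_ker Tb big1 // => i _.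
  by rewrite Lo ?scale0r //; exact: basis_family_mem.
have Limg : (L <= limg T)%VS.
  rewrite -(span_basis bL); apply/span_subvP => _ /mapP[i _ ->].
  have -> : b i = T (- f i).
    rewrite Tb (bigD1 i) //= big1 ?addr0 => [|j ji].
      by rewrite linearN /= -skewC fb eqxx scale1r.
    by rewrite linearN /= -skewC fb eq_sym (negbTE ji) scale0r.
  exact: memv_img (memvf _).
have := limg_ker_dim T fullv; rewrite capfv dV mul2n -addnn => dT.
have /eqP -> : L == lker T.
  rewrite eqEdim Lker -(leq_add2r (\dim L)) -dT leq_add2l.
  exact: dimvS.
rewrite memv_ker Tb big1 // => i _.
by rewrite skewC vL ?oppr0 ?scale0r //; exact: basis_family_mem.
Qed.

Lemma symplectic_basis n (phi : 'End(V)) L (b : 'I_n -> V) :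
  (forall u v, omega (phi u) (phi v) = omega u v) ->
  basis_of L [seq b i | i : 'I_n] ->
  basis_of (phi @: L) [seq phi (b i) | i : 'I_n].
Proof.
move=> phiO bL.
have -> : [seq phi (b i) | i : 'I_n] = map phi [seq b i | i : 'I_n].
  by rewrite -map_comp.
apply: limg_basis_of => //; apply/eqP; rewrite -subv0; apply/subvP => u.
rewrite memv_cap memv_ker memv0 => /andP[_ /eqP u0]; apply/eqP.
by apply: nondegenerate0 => v; rewrite -phiO u0 skewC linear0 oppr0.
Qed.

End Symplectic.

(** * The symplectic shears with a prescribed form *)

Section ShearGroup.
Variables (R : realType) (V : vectType R) (omega : {skew_symmetric V}).
Variables (n : nat) (G : 'M[R]_n) (b f : 'I_n -> V).
Hypothesis fb : forall i j, omega (f i) (b j) = (i == j)%:R.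
Hypothesis ff : forall i j, omega (f i) (f j) = 0.
Hypothesis Gsym : forall i j, G i j = G j i.

(** The endomorphism [A v = \sum_(i, j) (G i j * omega (f j) v) *: f i]
    takes its values in the span of the [f i], on which it vanishes. Hence
    [A \o A = 0], and [1 + t A] is the exponential of [t A]; symmetry of [G]
    says that [A] is in the symplectic Lie algebra. *)
Lemma shear_group : exists A : 'End(V),
  [/\ forall i, A (b i) = \sum_j G i j *: f j,
      one_parameter_subgroup omega (fun t => \1%VF + t *: A)
    & forall i j, omega (A (b i)) (b j) = G i j].
Proof.
have [A AE] := skew_tensor_lfun omega G f f; exists A.
have Ab i : A (b i) = \sum_j G i j *: f j.
  rewrite AE; apply: eq_bigr => j _; congr (_ *: _).
  rewrite (bigD1 i) //= fb eqxx mulr1 big1 ?addr0 // => k /negbTE ki.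
  by rewrite fb ki mulr0.
have fA i v : omega (f i) (A v) = 0.
  by rewrite AE skew_sumr big1 // => j _; rewrite ff mulr0.
have AA v : A (A v) = 0.
  rewrite AE big1 // => i _; rewrite big1 ?scale0r // => j _.
  by rewrite fA mulr0.
have AO u v : omega (A u) (A v) = 0.
  by rewrite [A u]AE skew_suml big1 // => i _; rewrite fA mulr0.
have Asym u v : omega (A u) v = omega (A v) u.
  rewrite !AE !skew_suml.
  under eq_bigr => i _ do rewrite mulr_suml.
  rewrite exchange_big; apply: eq_bigr => j _ /=.
  rewrite mulr_suml; apply: eq_bigr => i _.
  by rewrite Gsym -!mulrA [omega _ u * _]mulrC.
have phiE t v : (\1%VF + t *: A : 'End(V)) v = v + t *: A v.
  by rewrite add_lfunE scale_lfunE id_lfunE.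
split=> //.
- split=> [|s t|t u v|t v].
  + by rewrite scale0r addr0.
  + apply/lfunP => v; rewrite comp_lfunE !phiE [A (v + _)]linearD linearZ /= AA.
    by rewrite scaler0 addr0 scalerDl addrA addrAC.
  + rewrite !phiE skewDl !linearD !linearZ /= !skewZl AO.
    rewrite [omega u (A v)]skewC [omega (A v) u]Asym !mulr0 addr0.
    by rewrite mulrN addrNK.
  + have -> : (fun s => (\1%VF + s *: A : 'End(V)) v) = fun s => v + s *: A v.
      by apply/funext => s; rewrite phiE.
    by have [] := is_vderive_vderive (is_vderive_affine v (A v) t).
- move=> i j; rewrite Ab skew_suml (bigD1 j) //= fb eqxx mulr1 big1 ?addr0 //.
  by move=> k /negbTE kj; rewrite fb kj mulr0.
Qed.

End ShearGroup.

(** * Tangent vectors as symmetric matrices *)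

Section TangentForms.
Variables (R : realType) (V : vectType R) (n : nat).
Variable omega : {skew_symmetric V}.

Lemma is_derive_skew (c1 c2 : R -> V) t d1 d2 :
  is_vderive c1 t d1 -> is_vderive c2 t d2 ->
  is_derive t (1 : R) ((fun s => omega (c1 s) (c2 s)) : R -> R^o)
    (omega d1 (c2 t) + omega (c1 t) d2).
Proof.
move=> cd1 cd2; pose vb := vbasis {:V}.
have -> : (fun s => omega (c1 s) (c2 s)) =
    (fun s => \sum_i coord vb i (c1 s) * omega vb`_i (c2 s)).
  by apply/funext => s; rewrite {1}(vbasis_coordE (c1 s)) skew_suml.
rewrite (vbasis_coordE d1) [in omega (c1 t) _](vbasis_coordE (c1 t)).
rewrite !skew_suml -big_split /=; apply: is_derive_sumr => i.
exact: is_derive_mulr (cd1 i) (is_vderive_scalar (omega vb`_i) cd2).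
Qed.

Lemma moving_frame_basis (c : R -> {vspace V}) e :
  @moving_frame R V n c e -> basis_of (c 0) [seq e 0 i | i : 'I_n].
Proof. by move=> [/nbhs_singleton]. Qed.

Lemma moving_frame_is_vderive (c : R -> {vspace V}) e :
  @moving_frame R V n c e ->
  forall i, is_vderive (e ^~ i) 0 (vderive (e ^~ i) 0).
Proof. by move=> [_ ed] i; apply: vderivable_is_vderive. Qed.

Lemma moving_frame_comb (c : R -> {vspace V}) e (B : 'M[R]_n) :
  B \in unitmx -> moving_frame c e -> moving_frame c (fun t => mxcomb B (e t)).
Proof.
move=> Bu ce; have [cb _] := ce; split.
  by apply: filterS cb => t; exact: basis_comb.
move=> i; have ed := is_vderive_comb B (moving_frame_is_vderive ce) i.
by have [] := is_vderive_vderive ed.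
Qed.

Lemma vderive_comb (c : R -> {vspace V}) e (B : 'M[R]_n) i :
  moving_frame c e ->
  vderive (fun t => mxcomb B (e t) i) 0 =
    mxcomb B (fun j => vderive (e ^~ j) 0) i.
Proof.
move=> ce; have ed := is_vderive_comb B (moving_frame_is_vderive ce) i.
by have [] := is_vderive_vderive ed.
Qed.

(** Two frames of the same curve span the same Lagrangian planes, so
    [omega (e1 t i) (e2 t j)] vanishes near 0; this is its derivative. With
    [e1 = e2] it gives the symmetry of the form, and with [e1 <> e2] its
    independence of the frame, without differentiating a change of frame. *)
Lemma frame_pairing (c : R -> {vspace V}) (e1 e2 : R -> 'I_n -> V) i j :
  (forall t, lagrangian n omega (c t)) ->
  moving_frame c e1 -> moving_frame c e2 ->
  omega (vderive (e1 ^~ i) 0) (e2 0 j) = omega (vderive (e2 ^~ j) 0) (e1 0 i).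
Proof.
move=> cL ce1 ce2.
have d12 := is_derive_skew (moving_frame_is_vderive ce1 i)
  (moving_frame_is_vderive ce2 j).
have d0 : is_derive (0 : R) (1 : R)
    ((fun s => omega (e1 s i) (e2 s j)) : R -> R^o) 0.
  apply: (near_eq_is_derive _ (is_derive_cst (0 : R^o) _ _)).
  case: ce1 => b1 _; case: ce2 => b2 _; near=> s.
  apply/esym; have [_ Lo] := cL s.
  by apply: Lo; apply: basis_family_mem; near: s.
have := @derive_val _ _ _ _ _ _ _ d12; rewrite (@derive_val _ _ _ _ _ _ _ d0).
move=> /esym/eqP; rewrite addr_eq0 => /eqP ->.
by rewrite -(skewC omega (vderive _ _)).
Unshelve. all: by end_near. Qed.

(** [G] is the matrix in the basis [b] of the quadratic form attached to the
    velocity of [c]. *)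
Definition curve_form (c : R -> {vspace V}) (b : 'I_n -> V) (G : 'M[R]_n) :=
  exists e : R -> 'I_n -> V, [/\ moving_frame c e, e 0 = b
    & forall i j, omega (vderive (e ^~ i) 0) (b j) = G i j].

Lemma curve_form_comb c b G (B : 'M[R]_n) : B \in unitmx ->
  curve_form c b G -> curve_form c (mxcomb B b) (B *m G *m B^T).
Proof.
move=> Bu [e [ce e0 eG]]; exists (fun t => mxcomb B (e t)); split.
- exact: moving_frame_comb.
- by rewrite e0.
move=> i j; rewrite (vderive_comb _ _ ce) skew_sumr mxE; apply: eq_bigr => k _.
rewrite skew_suml !mxE [RHS]mulrC; congr (_ * _); apply: eq_bigr => l _.
by rewrite eG.
Qed.

Variable L : {vspace V}.

Lemma curve_form_exists c b : lagrangian_curve n omega L c ->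
  basis_of L [seq b i | i : 'I_n] -> exists G, curve_form c b G.
Proof.
case=> c0 _ [e fr] bL; have eL := moving_frame_basis fr.
rewrite c0 in eL; have [B Bu bE] := basis_change eL bL.
exists (\matrix_(i, j) omega (vderive (fun t => mxcomb B (e t) i) 0) (b j)).
exists (fun t => mxcomb B (e t)); split.
- exact: moving_frame_comb.
- by rewrite bE.
- by move=> i j; rewrite mxE.
Qed.

Lemma curve_form_sym c b G i j : lagrangian_curve n omega L c ->
  curve_form c b G -> G i j = G j i.
Proof.
move=> [_ cL _] [e [ce e0 eG]]; rewrite -!eG -e0.
exact: (frame_pairing _ _ cL ce ce).
Qed.

(** [same_velocity] provides frames starting at some common basis, which a
    constant change of basis moves to [b]. The given frames are compared with
    these by [frame_pairing]; the difference of the two velocities lies in [L]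
    and is thus orthogonal to [L]. *)
Lemma same_velocity_form c1 c2 b G1 G2 :
  lagrangian_curve n omega L c1 -> lagrangian_curve n omega L c2 ->
  same_velocity n c1 c2 -> curve_form c1 b G1 -> curve_form c2 b G2 -> G1 = G2.
Proof.
move=> [c10 c1L _] [c20 c2L _] [f1 [f2 [cf1 cf2 f12 fd]]].
move=> [e1 [ce1 e10 eG1]] [e2 [ce2 e20 eG2]].
have := moving_frame_basis ce1; rewrite e10 => bc.
have [B Bu bE] := basis_change (moving_frame_basis cf1) bc.
apply/matrixP => i j; rewrite -eG1 -eG2.
have -> : omega (vderive (e1 ^~ i) 0) (b j) =
    omega (vderive (fun t => mxcomb B (f1 t) j) 0) (b i).
  rewrite -{2}e10 -(frame_pairing i j c1L ce1 (moving_frame_comb Bu cf1)).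
  by rewrite bE.
have -> : omega (vderive (e2 ^~ i) 0) (b j) =
    omega (vderive (fun t => mxcomb B (f2 t) j) 0) (b i).
  rewrite -{2}e20 -(frame_pairing i j c2L ce2 (moving_frame_comb Bu cf2)).
  by rewrite bE f12.
rewrite (vderive_comb _ _ cf1) (vderive_comb _ _ cf2) !skew_suml.
apply: eq_bigr => k _; congr (_ * _); apply/eqP; rewrite -subr_eq0.
have [_ Lo] := c1L 0; rewrite -[- _]mulN1r -skewZl -skewDl scaleN1r.
by rewrite Lo ?fd ?(basis_family_mem _ bc).
Qed.

Hypothesis (dimV : \dim {:V} = (2 * n)%N) (omega_nd : nondegenerate omega).
Hypothesis LL : lagrangian n omega L.

(** The difference of the velocities is orthogonal to [L], hence in [L]. *)
Lemma form_same_velocity c1 c2 b G : c1 0 = L ->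
  curve_form c1 b G -> curve_form c2 b G -> same_velocity n c1 c2.
Proof.
move=> c10 [e1 [ce1 e10 eG1]] [e2 [ce2 e20 eG2]].
have := moving_frame_basis ce1; rewrite e10 c10 => bL.
exists e1, e2; split=> //; first by rewrite e10.
move=> i; rewrite c10; apply: (lagrangian_maximal omega_nd dimV LL) => u.
rewrite -(span_basis bL) => /span_familyP [a ->].
rewrite skew_sumr big1 // => j _; rewrite skewDl -scaleN1r skewZl mulN1r.
by rewrite eG1 eG2 subrr mulr0.
Qed.

Lemma velocity_formP c0 b G c : lagrangian_curve n omega L c0 ->
  basis_of L [seq b i | i : 'I_n] -> curve_form c0 b G ->
  velocity n omega L c0 c <-> lagrangian_curve n omega L c /\ curve_form c b G.
Proof.
move=> c0L bL c0G; split=> [[cL cv]|[cL cG]].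
  split=> //; have [G' cG'] := curve_form_exists cL bL.
  by rewrite (same_velocity_form c0L cL cv c0G cG').
split=> //; apply: form_same_velocity c0G cG; by case: c0L.
Qed.

Lemma tangent_space_form Ldot b : tangent_space n omega L Ldot ->
  basis_of L [seq b i | i : 'I_n] ->
  exists G : 'M[R]_n, (forall i j, G i j = G j i) /\
    forall c, Ldot c <-> lagrangian_curve n omega L c /\ curve_form c b G.
Proof.
move=> [c0 c0L <-] bL; have [G c0G] := curve_form_exists c0L bL.
exists G; split=> [i j|c]; first exact: curve_form_sym c0L c0G.
exact: velocity_formP.
Qed.

Lemma tangent_zero_form b c : basis_of L [seq b i | i : 'I_n] ->
  tangent_zero n omega L c <->
  lagrangian_curve n omega L c /\ curve_form c b 0.
Proof.
move=> bL; have bf : moving_frame (fun=> L) (fun=> b).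
  split=> [|i]; first by apply: filterE => t; exact: bL.
  by have [] := is_vderive_vderive (is_vderive_cst (b i) 0).
apply: velocity_formP => //; first by split=> //; exists (fun=> b).
exists (fun=> b); split=> // i j; rewrite mxE.
have [_ ->] := is_vderive_vderive (is_vderive_cst (b i) 0).
by rewrite skewC linear0 oppr0.
Qed.

(** For the orbit of [L] under a one-parameter group, the images of [b] form a
    moving frame. *)
Lemma group_curve phi b : one_parameter_subgroup omega phi ->
  basis_of L [seq b i | i : 'I_n] ->
  lagrangian_curve n omega L (fun t => (phi t @: L)%VS) /\
  curve_form (fun t => (phi t @: L)%VS) b
    (\matrix_(i, j) omega (vderive (fun t => phi t (b i)) 0) (b j)).
Proof.
move=> [phi0 _ phiO phid] bL.
have fr : moving_frame (fun t => (phi t @: L)%VS) (fun t i => phi t (b i)).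
  split=> [|i]; last exact: phid.
  by apply: filterE => t; exact: (symplectic_basis omega_nd (phiO t) bL).
split; first split.
- by rewrite phi0 lim1g.
- move=> t; have tb := symplectic_basis omega_nd (phiO t) bL; split.
    have [/eqP tL /eqP] := andP tb.
    by rewrite tL size_family.
  have [_ Lo] := LL.
  by move=> _ _ /memv_imgP [u uL ->] /memv_imgP [v vL ->]; rewrite phiO Lo.
- by exists (fun t i => phi t (b i)).
exists (fun t i => phi t (b i)); split=> //.
  by apply/funext => i; rewrite phi0 id_lfunE.
by move=> i j; rewrite mxE.
Qed.

Lemma shear_curve b (f : 'I_n -> V) (G : 'M[R]_n) :
  basis_of L [seq b i | i : 'I_n] ->
  (forall i j, omega (f i) (b j) = (i == j)%:R) ->
  (forall i j, omega (f i) (f j) = 0) -> (forall i j, G i j = G j i) ->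
  exists A : 'End(V), [/\ forall i, A (b i) = \sum_j G i j *: f j,
    one_parameter_subgroup omega (fun t => \1%VF + t *: A),
    forall i j, omega (A (b i)) (b j) = G i j
    & curve_form (fun t => ((\1%VF + t *: A) @: L)%VS) b G].
Proof.
move=> bL fb ff Gs; have [A [Ab Ag AG]] := shear_group fb ff Gs.
exists A; split=> //; have [_ ] := group_curve Ag bL; congr curve_form.
apply/matrixP => i j; rewrite mxE -AG; congr (omega _ _).
have -> : (fun t => (\1%VF + t *: A : 'End(V)) (b i)) =
    fun t => b i + t *: A (b i).
  by apply/funext => t; rewrite add_lfunE scale_lfunE id_lfunE.
by have [] := is_vderive_vderive (is_vderive_affine (b i) (A (b i)) 0).
Qed.

End TangentForms.

Section TangentRank.
Variables (R : realType) (V : vectType R) (omega : {skew_symmetric V}).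
Variables (L : {vspace V}) (Ldot : set (R -> {vspace V})).
Let n := \dim L.
Let b (i : 'I_n) := (vbasis L)`_i.
Hypothesis (dimV : \dim {:V} = (2 * n)%N) (omega_nd : nondegenerate omega).
Hypothesis LL : lagrangian n omega L.

(** The shear of matrix [G] shows that a generating one-parameter group exists,
    so the chosen generator does generate [Ldot], and its matrix is [G] because
    a tangent vector has only one matrix. *)
Lemma tangent_rank_form (G : 'M[R]_n) : (forall i j, G i j = G j i) ->
  (forall c, Ldot c <->
    lagrangian_curve n omega L c /\ curve_form omega c b G) ->
  tangent_rank omega L Ldot = \rank G.
Proof.
move=> Gs LG; have bL : basis_of L [seq b i | i : 'I_n] := basis_vbasis erefl.
have [f [fb ff]] := lagrangian_dual omega_nd LL bL.
have [A [_ Ag _ AG]] := shear_curve omega_nd LL bL fb ff Gs.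
have [Ac _] := group_curve omega_nd LL Ag bL.
set S := [set phi : R -> 'End(V) | one_parameter_subgroup omega phi /\
       Ldot (fun t => (phi t @: L)%VS)].
have [gg /LG [gL gG]] : S (generator omega L Ldot).
  by apply: xgetPex; exists (fun t => \1%VF + t *: A); split=> //; apply/LG.
have [_ gG'] := group_curve omega_nd LL gg bL.
have sv : same_velocity n (fun t => (generator omega L Ldot t @: L)%VS)
   (fun t => (generator omega L Ldot t @: L)%VS).
  by apply: (form_same_velocity dimV omega_nd LL _ gG gG); case: gL.
by rewrite -(same_velocity_form gL gL sv gG' gG).
Qed.

End TangentRank.

(** * Matrices of rank one *)

Section MatrixRank.
Variables (R : realType) (n : nat).
Implicit Types (G H K P Q : 'M[R]_n).

(** Both sides are the determinant of the block matrix with rows [(1, - v)] and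
    [(u, 1)], eliminated in the two possible ways. *)
Lemma det_add1_rank1 (u : 'cV[R]_n) (v : 'rV[R]_n) :
  \det (1%:M + u *m v) = 1 + (v *m u) 0 0.
Proof.
have E1 : block_mx 1%:M (- v) u 1%:M =
    block_mx 1%:M 0 u 1%:M *m block_mx 1%:M (- v) 0 (1%:M + u *m v).
  rewrite mulmx_block !mul1mx !mulmx1 !mul0mx !addr0 mulmxN.
  by rewrite addrCA addNr addr0.
have E2 : block_mx 1%:M (- v) u 1%:M =
    block_mx (1%:M + v *m u) (- v) 0 1%:M *m block_mx 1%:M 0 u 1%:M.
  by rewrite mulmx_block !mul1mx !mulmx1 !mul0mx !mulmx0 !add0r mulNmx addrK.
have := congr1 determinant E1; rewrite E2 !det_mulmx !det_ublock !det_lblock.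
by rewrite !det1 !mulr1 !mul1r => <-; rewrite det_mx11 !mxE.
Qed.

Lemma det_add1_pid r : (r <= n)%N -> \det (1%:M + pid_mx r : 'M[R]_n) = 2 ^+ r.
Proof.
move=> rn.
have -> : 1%:M + pid_mx r =
    diag_mx (\row_i (if (i < r)%N then 2 else 1)) :> 'M[R]_n.
  apply/matrixP => i j; rewrite !mxE.
  case: eqVneq => [<-|ij]; rewrite ?eqxx /=.
    by case: ifP => _; rewrite ?addr0 // mulr1n -natrD.
  by rewrite (negbTE (_ : nat_of_ord i != j)) ?addr0.
rewrite det_diag; under eq_bigr => i _ do rewrite mxE.
by rewrite -big_mkcond -(big_ord_widen _ (fun=> 2) rn) /= prodr_const card_ord.
Qed.

Lemma mxtrace_pid r : (r <= n)%N -> \tr (pid_mx r : 'M[R]_n) = r%:R.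
Proof.
move=> rn; rewrite /mxtrace.
under eq_bigr => i _ do rewrite mxE eqxx mulrb.
by rewrite -big_mkcond -(big_ord_widen _ (fun=> 1) rn) /= sumr_const card_ord.
Qed.

(** Taking [K = 0] makes [P] invertible, so one may assume [P = 1] with [Q]
    replaced by [H = invmx P *m Q]. Elementary matrices [K] then identify the
    entries of [H] with those of [G]. Finally, some [K] makes [G *m K]
    conjugate to the projection of rank [r = \rank G], for which the equation
    reads [2 ^+ r = 1 + r]. *)
Lemma rank1_of_graph_minors G P Q (l : R) : G != 0 ->
  (forall K, l * \det (P + Q *m K) = 1 + \tr (G *m K)) -> \rank G = 1%N.
Proof.
move=> G0 GPQ.
have lP : l * \det P = 1 by have := GPQ 0; rewrite !mulmx0 mxtrace0 !addr0.
have Pu : P \in unitmx.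
  rewrite unitmxE unitfE; apply: contra_eq_neq lP => ->.
  by rewrite mulr0 eq_sym oner_neq0.
pose H := invmx P *m Q.
have HG K : \det (1%:M + H *m K) = 1 + \tr (G *m K).
  have -> : 1%:M + H *m K = invmx P *m (P + Q *m K).
    by rewrite mulmxDr mulVmx // mulmxA.
  by rewrite -GPQ det_mulmx det_inv -(mulr1_eq lP) invrK.
have GH : G = H.
  apply/matrixP => i j; have := HG (delta_mx j i).
  have -> : delta_mx j i = delta_mx j 0 *m delta_mx (0 : 'I_1) i :> 'M[R]_n.
    by rewrite mul_delta_mx.
  rewrite !mulmxA det_add1_rank1 mxtrace_mulC => /addrI.
  by rewrite trace_mx11 -!rowE -!colE !mxE => ->.
set r := \rank G; have rn : (r <= n)%N := rank_leq_row G.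
pose K := invmx (row_ebase G) *m invmx (col_ebase G).
have GK : G *m K = col_ebase G *m pid_mx r *m invmx (col_ebase G).
  rewrite -{1}[G]mulmx_ebase /K !mulmxA mulmxK //.
  exact: row_ebase_unit.
have := HG K; rewrite -GH GK -mulmxA mxtrace_mulC -mulmxA.
rewrite mulVmx ?col_ebase_unit //.
rewrite mulmx1 mxtrace_pid //.
have -> : 1%:M + col_ebase G *m (pid_mx r *m invmx (col_ebase G)) =
    col_ebase G *m (1%:M + pid_mx r) *m invmx (col_ebase G).
  by rewrite mulmxDr mulmxDl mulmx1 mulmxV ?col_ebase_unit // mulmxA.
rewrite !det_mulmx mulrC mulrA -det_mulmx mulVmx ?col_ebase_unit // det1 mul1r.
rewrite det_add1_pid // -natrX -mulrS => /eqP.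
have : r != 0%N by rewrite mxrank_eq0.
rewrite eqr_nat; case: (r) => [|[|k]] // _.
have := @ltn_expl 2 k.+1 isT; rewrite [(2 ^ k.+2)%N]expnS.
move: (2 ^ k.+1)%N => N; lia.
Qed.

(** Gaussian elimination on the rows clears all rows of [G] but one, and so all
    columns of the congruent matrix but one, by symmetry. *)
Lemma rank1_congruence G : (forall i j, G i j = G j i) -> \rank G = 1%N ->
  exists (B : 'M[R]_n) (k : 'I_n), B \in unitmx /\
    forall i j, i != k \/ j != k -> (B *m G *m B^T) i j = 0.
Proof.
move=> Gs G1; pose B := invmx (col_ebase G).
have n0 : (0 < n)%N by rewrite -G1 rank_leq_row.
pose k := Ordinal n0.
have row0 i j : i != k -> (B *m G *m B^T) i j = 0.
  move=> ik; rewrite -[G]mulmx_ebase /B !mulmxA mulVmx ?col_ebase_unit //.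
  rewrite mul1mx G1 -mulmxA mxE big1 // => l _; rewrite mxE.
  have /negbTE -> : ~~ (i < 1)%N by rewrite ltnS leqn0.
  by rewrite andbF mul0r.
have sym i j : (B *m G *m B^T) i j = (B *m G *m B^T) j i.
  have GT : G^T = G by apply/matrixP => a c; rewrite mxE.
  have XT : (B *m G *m B^T)^T = B *m G *m B^T.
    by rewrite !trmx_mul trmxK GT mulmxA.
  by rewrite -[in LHS]XT [LHS]mxE.
exists B, k; split; first by rewrite unitmx_inv col_ebase_unit.
by move=> i j [ik|jk]; [exact: row0|rewrite sym row0].
Qed.

End MatrixRank.

(** * The tangent line in the exterior power *)

Section Wedge.
Variables (R : realType) (V : vectType R) (n : nat) (E : exterior_power V n).
Variable omega : {skew_symmetric V}.

(** These functionals give access to the coordinates of a wedge, hence of a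
    point of the Grassmannian; they come from the universal property. *)
Lemma wedge_det (z : 'I_n -> V) : exists psi : 'Hom(E, R^o),
  forall x, psi (wedge E x) = \det (\matrix_(i, j) omega (z j) (x i)).
Proof.
pose h (x : 'I_n -> V) : R^o := \det (\matrix_(i, j) omega (z j) (x i)).
suff hA : alternating_map h.
  by have [psi [psiE _]] := wedge_universal E hA; exists psi.
split=> [x i a u v|x i j ij xij]; last first.
  by apply: (determinant_alternate ij) => k; rewrite !mxE xij.
rewrite /h (@determinant_multilinear _ _ _
  (\matrix_(k, j) omega (z j) (update x i u k))
  (\matrix_(k, j) omega (z j) (update x i v k)) i a 1) ?mul1r //.
- by apply/rowP => k; rewrite !mxE !update_self linearP mul1r.
- apply/matrixP => k l; rewrite !mxE.
  by rewrite !update_neq // eq_sym neq_lift.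
- apply/matrixP => k l; rewrite !mxE.
  by rewrite !update_neq // eq_sym neq_lift.
Qed.

Lemma pluecker_basis (L : {vspace V}) (b : 'I_n -> V) :
  basis_of L [seq b i | i : 'I_n] -> pluecker E L = <[wedge E b]>%VS.
Proof.
move=> bL; have dL : \dim L = n.
  by have [/eqP <- /eqP ->] := andP bL; rewrite size_family.
exact: (alternating_basis (wedge_alternating E) bL (basis_vbasis dL)).
Qed.

(** A homogeneous lift [w] is proportional to the lift [wedge E (e t)] given by
    a frame, but nothing is known about the factor. Applying [psi] eliminates
    it: [psi (wedge E (e t)) *: w t = psi (w t) *: wedge E (e t)], and both
    sides can be differentiated. *)
Lemma tangent_plane (c : R -> {vspace V}) (e : R -> 'I_n -> V) (w : R -> E)
    (psi : 'Hom(E, R^o)) :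
  moving_frame c e -> psi (wedge E (e 0)) = 1 ->
  (\forall t \near (0 : R), pluecker E (c t) = <[w t]>%VS) -> vderivable w 0 ->
  (<[w 0%R]> + <[vderive w 0%R]> <= <[wedge E (e 0%R)]> +
    <[\sum_i wedge E (update (e 0%R) i (vderive (e ^~ i) 0))]>)%VS.
Proof.
move=> ce psi1 cw wd.
set W := wedge E (e 0); set W' := \sum_i _.
have wtd : is_vderive (fun t => wedge E (e t)) 0 W'.
  exact: is_vderive_multilinear (wedge_alternating E).1
    (moving_frame_is_vderive ce).
have prop : \forall t \near (0 : R), exists k, w t = k *: wedge E (e t).
  case: ce => cb _; near=> t; apply/vlineP.
  have <- : pluecker E (c t) = <[wedge E (e t)]>%VS.
    by apply: pluecker_basis; near: t.
  have -> : pluecker E (c t) = <[w t]>%VS by near: t.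
  exact: memv_line.
have [k wk] := nbhs_singleton prop.
have crossed : \forall t \near (0 : R),
    psi (wedge E (e t)) *: w t = psi (w t) *: wedge E (e t).
  apply: filterS prop => t [a ->].
  by rewrite scalerA [in RHS]linearZ; congr (_ *: _); exact: mulrC.
have wD := vderivable_is_vderive wd.
have D1 := is_vderiveZ (is_vderive_scalar psi wtd) wD.
have D2 := is_vderiveZ (is_vderive_scalar psi wD) wtd.
have := is_vderive_unique (near_is_vderive crossed D1) D2.
rewrite /= psi1 scale1r => dw.
have -> : vderive w 0 =
    psi (vderive w 0) *: W + psi (w 0) *: W' - psi W' *: w 0.
  by rewrite -dw addrC addKr.
rewrite subv_add -!memvE wk; apply/andP; split.
  by apply: (subvP (addvSl _ _)); apply: memvZ; exact: memv_line.
rewrite addrAC scalerA -scalerBl.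
by apply: memv_add; apply: memvZ; exact: memv_line.
Unshelve. all: by end_near. Qed.

(** A family with nonzero wedge is free, so its span has dimension [n]. *)
Lemma pluecker_lagrangian (x : 'I_n -> V) : wedge E x != 0 ->
  (forall i j, omega (x i) (x j) = 0) ->
  exists2 M, lagrangian n omega M & pluecker E M = <[wedge E x]>%VS.
Proof.
move=> x0 xx; have xf := alternating_free (wedge_alternating E) x0.
exists <<[seq x i | i : 'I_n]>>%VS; last first.
  by apply: pluecker_basis; rewrite /basis_of eqxx.
split; first by rewrite (eqP xf) size_family.
move=> u v /span_familyP [a ->] /span_familyP [a' ->].
rewrite skew_suml big1 // => i _; rewrite skew_sumr big1 ?mulr0 // => j _.
by rewrite xx mulr0.
Qed.

Hypothesis (dimV : \dim {:V} = (2 * n)%N) (omega_nd : nondegenerate omega).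
Variable L : {vspace V}.
Hypothesis LL : lagrangian n omega L.
Variable Ldot : set (R -> {vspace V}).

Lemma dual_det1 (b f : 'I_n -> V) :
  (forall i j, omega (f i) (b j) = (i == j)%:R) ->
  \det (\matrix_(i, j) omega (f j) (b i)) = 1.
Proof.
move=> fb; rewrite -[RHS](det1 _ n); congr determinant.
by apply/matrixP => i j; rewrite !mxE fb eq_sym.
Qed.

(** Modulo [W], only the [k]-th term of [W'] survives: for [i != k] the velocity
    of [e ^~ i] is orthogonal to [L], so it lies in [L] and the [i]-th term is a
    multiple of [W]. The remaining two wedges differ in one argument only, so
    every combination of them is again a wedge. *)
Lemma rank1_line_lagrangian (b : 'I_n -> V) (G : 'M[R]_n) (k : 'I_n) :
  basis_of L [seq b i | i : 'I_n] ->
  (forall c, Ldot c ->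
    lagrangian_curve n omega L c /\ curve_form omega c b G) ->
  (forall i j, i != k \/ j != k -> G i j = 0) ->
  tangent_line E Ldot `<=` [set pluecker E M | M in lagrangian n omega].
Proof.
move=> bL LG Gk p [p1 [c [w [/LG [cL [e [ce e0 eG]]] cw wd pw]]]].
have [f [fb _]] := lagrangian_dual omega_nd LL bL.
have [psi psiE] := wedge_det f.
have psib : psi (wedge E (e 0)) = 1 by rewrite psiE e0 dual_det1.
have := subv_trans pw (tangent_plane ce psib cw wd); rewrite e0.
set d := fun i => vderive (e ^~ i) 0; set W' := \sum_i _ => pWW'.
have W'E : W' \in (<[wedge E b]> + <[wedge E (update b k (d k))]>)%VS.
  rewrite /W' (bigD1 k) //= addrC; apply: memv_add; last exact: memv_line.
  apply: memv_suml => i ik.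
  apply: (alternating_span (wedge_alternating E)) => j.
  rewrite (span_basis bL) /update; case: eqP => _; last exact: basis_family_mem.
  apply: (lagrangian_maximal omega_nd dimV LL) => u.
  rewrite -(span_basis bL) => /span_familyP [a ->].
  rewrite skew_sumr big1 // => l _; rewrite eG Gk ?mulr0 //; by left.
have [v v0 pE] := dim1_line p1.
have : v \in (<[wedge E b]> + <[wedge E (update b k (d k))]>)%VS.
  apply: (subvP _ v (_ : v \in (<[wedge E b]> + <[W']>)%VS)).
    by rewrite subv_add -[X in _ && X]memvE W'E addvSl.
  by apply: (subvP pWW'); rewrite pE memv_line.
move=> /memv_addP [_ /vlineP [al ->] [_ /vlineP [be ->] vE]].
pose x := update b k (al *: b k + be *: d k).
have xE : v = wedge E x.
  have [M _] := wedge_alternating E.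
  rewrite vE /x M -[be *: d k]addr0 M multilinear0 // addr0.
  by rewrite update_id.
have bb i j : omega (b i) (b j) = 0.
  by have [_ ->] := LL => //; exact: basis_family_mem.
have kx j : j != k -> omega (al *: b k + be *: d k) (b j) = 0.
  by move=> jk; rewrite skewDl !skewZl bb eG Gk ?mulr0 ?addr0 //; right.
have [|i j|M ML ME] := @pluecker_lagrangian x; first by rewrite -xE.
  rewrite /x /update; case: eqVneq => [_|ik]; case: eqVneq => [_|jk] //.
  - exact: skew_self.
  - exact: kx.
  - by rewrite skewC kx ?oppr0.
by exists M => //; rewrite ME pE xE.
Qed.

(** The line is computed along the curve [(1 + t A) L] and its lift
    [wedge E (fun i => b i + t *: A (b i))]; its point [W + W'] is a wedge, and
    the functionals of [wedge_det] turn this into the hypothesis of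
    [rank1_of_graph_minors]. *)
Lemma line_lagrangian_rank1 (b : 'I_n -> V) (G : 'M[R]_n) :
  basis_of L [seq b i | i : 'I_n] -> G != 0 -> (forall i j, G i j = G j i) ->
  (forall c, lagrangian_curve n omega L c ->
    curve_form omega c b G -> Ldot c) ->
  tangent_line E Ldot `<=` [set pluecker E M | M in lagrangian n omega] ->
  \rank G = 1%N.
Proof.
move=> bL G0 Gs LG lineL.
have [f [fb ff]] := lagrangian_dual omega_nd LL bL.
have [A [Ab Ag Abb AG]] := shear_curve omega_nd LL bL fb ff Gs.
have [Ac _] := group_curve omega_nd LL Ag bL.
have fA i j : omega (f j) (A (b i)) = 0.
  by rewrite Ab skew_sumr big1 // => k _; rewrite ff mulr0.
pose W := wedge E b; pose W' := \sum_i wedge E (update b i (A (b i))).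
have test K : exists psi : 'Hom(E, R^o),
    psi (W + W') = 1 + \tr (G *m K) /\
    forall x, psi (wedge E x) = \det (\matrix_(i, j) omega (f j) (x i) +
      (\matrix_(i, j) omega (x i) (b j)) *m K).
  (* [omega (f j)] and [- omega (b l)] are the coordinates along [b j] and
     [f l], so pairing with these vectors computes [P + Q K]. *)
  have [psi psiE] := wedge_det (fun j => f j - \sum_l K l j *: b l).
  have zE j v : omega (f j - \sum_l K l j *: b l) v =
      omega (f j) v + \sum_l omega v (b l) * K l j.
    rewrite skewDl -scaleN1r skewZl mulN1r skew_suml; congr (_ + _).
    rewrite -sumrN; apply: eq_bigr => l _.
    by rewrite [omega v _]skewC mulNr mulrC.
  have psiM x : psi (wedge E x) = \det (\matrix_(i, j) omega (f j) (x i) +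
      (\matrix_(i, j) omega (x i) (b j)) *m K).
    rewrite psiE; congr determinant; apply/matrixP => i j; rewrite !mxE zE.
    by congr (_ + _); apply: eq_bigr => l _; rewrite mxE.
  exists psi; split=> //.
  have bb i j : omega (b i) (b j) = 0.
    by have [_ ->] := LL => //; exact: basis_family_mem.
  rewrite linearD linear_sum /=; congr (_ + _).
    rewrite psiE -[RHS](det1 _ n); congr determinant; apply/matrixP => i j.
    rewrite !mxE zE fb big1 ?addr0 1?eq_sym // => l _.
    by rewrite bb mul0r.
  apply: eq_bigr => i _; rewrite psiE; set N := (X in \det X).
  (* [N] is the identity matrix with its [i]-th row replaced by that of
     [G *m K]. *)
  pose v := row i (G *m K) - delta_mx 0 i.
  have -> : N = 1%:M + delta_mx i 0 *m v.
    apply/matrixP => p q; rewrite !mxE zE big_ord1 !mxE eqxx /=.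
    case: (eqVneq p i) => [->|pi]; last first.
      rewrite update_neq // fb big1 ?mul0r ?addr0 1?eq_sym // => l _.
      by rewrite bb mul0r.
    rewrite update_self mul1r fA add0r eq_sym addrC subrK.
    by apply: eq_bigr => l _; rewrite Abb.
  by rewrite det_add1_rank1 -colE !mxE !eqxx addrCA subrr addr0.
pose w t := wedge E (fun i => b i + t *: A (b i)).
have w0 : w 0 = W.
  by congr (wedge E); apply/funext => i; rewrite scale0r addr0.
have wD : is_vderive w 0 W'.
  have := is_vderive_multilinear (wedge_alternating E).1
    (fun i => is_vderive_affine (b i) (A (b i)) 0).
  have -> // : \sum_i wedge E (update (fun j => b j + 0 *: A (b j)) i (A (b i)))
    = W'.
  apply: eq_bigr => i _; congr (wedge E (update _ _ _)).
  by apply/funext => j; rewrite scale0r addr0.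
have [wd wE] := is_vderive_vderive wD.
have WW0 : W + W' != 0.
  have [psi [psiE _]] := test 0; apply: contra_eq_neq psiE => ->.
  by rewrite linear0 mulmx0 mxtrace0 addr0 eq_sym oner_neq0.
have [|M ML ME] := lineL <[W + W']>%VS.
  split; first by rewrite dim_vline WW0.
  exists (fun t => ((\1%VF + t *: A) @: L)%VS), w; split=> //.
  - exact: LG.
  - apply: filterE => t; rewrite /w; case: Ag => _ _ AO _.
    rewrite (pluecker_basis (symplectic_basis omega_nd (AO t) bL)).
    congr (<[wedge E _]>)%VS; apply/funext => i.
    by rewrite add_lfunE scale_lfunE id_lfunE.
  - by rewrite w0 wE -memvE; apply: memv_add; exact: memv_line.
have : W + W' \in pluecker E M by rewrite ME memv_line.
move=> /vlineP [l lE].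
pose x i : V := (vbasis M)`_(nat_of_ord (i : 'I_n)).
apply: (rank1_of_graph_minors (l := l) (P := \matrix_(i, j) omega (f j) (x i))
  (Q := \matrix_(i, j) omega (x i) (b j)) G0) => K.
have [psi [psiE psiX]] := test K.
by rewrite -psiE lE linearZ /= -psiX.
Qed.

End Wedge.

Theorem proposition2p4 (R : realType) (V : vectType R) (n : nat)
    (omega : {skew_symmetric V}) (E : exterior_power V n)
    (L : {vspace V}) (Ldot : set (R -> {vspace V})) :
  \dim {:V} = (2 * n)%N ->
  nondegenerate omega ->
  lagrangian n omega L ->
  tangent_space n omega L Ldot ->
  Ldot <> tangent_zero n omega L ->
  (tangent_line E Ldot `<=` [set pluecker E M | M in lagrangian n omega]) <->
  tangent_rank omega L Ldot = 1%N.
Proof.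
move=> dimV omega_nd LL TL Ldot0; have [dL _] := LL; subst n.
have bL := basis_vbasis (erefl (\dim L)).
have [G [Gs LG]] := tangent_space_form dimV omega_nd LL TL bL.
rewrite (tangent_rank_form dimV omega_nd LL Gs LG).
split=> [|G1].
  apply: (line_lagrangian_rank1 omega_nd LL bL) => // [|c cL cG]; last exact/LG.
  apply: contra_notN Ldot0 => /eqP G0; apply/seteqP; split=> c.
    by move/LG; rewrite G0; apply: (tangent_zero_form dimV omega_nd LL c bL).2.
  move=> /(tangent_zero_form dimV omega_nd LL c bL) Lc.
  by apply/LG; rewrite G0.
have [B [k [Bu Bk]]] := rank1_congruence Gs G1.
apply: (rank1_line_lagrangian dimV omega_nd LL (basis_comb Bu bL) _ Bk).
by move=> c /LG [cL cG]; split=> //; exact: curve_form_comb.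
Qed.
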